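(* Let $p>3$ be a prime. Then $$\sum_{n=0}^{(p-1)/2}\frac{3n+1}{(-8)^n}\binom{2n}{n}^3\equiv p\left(\frac{-1}{p}\right)+\frac{p^3}{4}\left(\frac{2}{p}\right)E_{p-3}\left(\frac14\right)\pmod{p^4}.$$
   Context: $\left(\frac{\cdot}{p}\right)$ is the Legendre symbol. The Euler polynomials $E_n(x)$ are defined by $\frac{2e^{xt}}{e^t+1}=\sum_{n=0}^\infty E_n(x)\frac{t^n}{n!}$ ($|t|<\pi$). Congruences are between rational numbers whose denominators are prime to $p$: $a\equiv b\pmod{p^m}$ means that $(a-b)/p^m$ is a rational number with denominator prime to $p$. *)

(* Defs.v *)
From HB Require Import structures.
From mathcomp Require Import all_boot all_order all_algebra.
Set Implicit Arguments.
Unset Strict Implicit.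
Unset Printing Implicit Defensive.
Import Order.TTheory GRing.Theory Num.Theory.
Local Open Scope ring_scope.

Definition legendre (a : int) (p : nat) : int :=
  if (p %| a)%Z then 0
  else if [exists x : 'I_p, (p %| x%:Z ^+ 2 - a)%Z] then 1 else -1.

Definition congr_rat (p m : nat) (a b : rat) : bool :=
  coprime `|denq ((a - b) / p%:R ^+ m)| p.

(* Formal power series in t, as coefficient sequences over a ring. *)
Section FormalSeries.
Variable A : comUnitRingType.
Implicit Types f g : nat -> A.

Definition fps_mul f g (n : nat) : A := \sum_(i < n.+1) f i * g (n - i)%N.

(* The first n coefficients of 1 / f, obtained by solving f * g = 1 degree by
   degree; meaningful when the constant coefficient f 0 is a unit. *)
Fixpoint fps_inv_seq f (n : nat) : seq A :=
  if n is m.+1 then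
    let s := fps_inv_seq f m in
    rcons s ((f 0%N)^-1 * ((m == 0%N)%:R - \sum_(i < m) s`_i * f (m - i)%N))
  else [::].

Definition fps_inv f (n : nat) : A := (fps_inv_seq f n.+1)`_n.

Definition fps_div f g : nat -> A := fps_mul f (fps_inv g).

Lemma size_fps_inv_seq f n : size (fps_inv_seq f n) = n.
Proof. by elim: n => //= n IHn; rewrite size_rcons IHn. Qed.

Lemma nth_fps_inv_seq f n i : (i < n)%N -> (fps_inv_seq f n)`_i = fps_inv f i.
Proof.
elim: n => // n IHn; rewrite ltnS leq_eqVlt => /predU1P[->//|lt_in].
by rewrite /= nth_rcons size_fps_inv_seq lt_in IHn.
Qed.

Lemma fps_invE f n :
  fps_inv f n =
  (f 0%N)^-1 * ((n == 0%N)%:R - \sum_(i < n) fps_inv f i * f (n - i)%N).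
Proof.
rewrite {1}/fps_inv /= nth_rcons size_fps_inv_seq ltnn eqxx.
by congr (_ * (_ - _)); apply: eq_bigr => i _; rewrite nth_fps_inv_seq.
Qed.

Lemma fps_mulVf f n :
  f 0%N \is a GRing.unit -> fps_mul (fps_inv f) f n = (n == 0%N)%:R.
Proof.
move=> f0; rewrite /fps_mul big_ord_recr /= subnn (fps_invE f n).
by rewrite mulrAC mulVr // mul1r addrC subrK.
Qed.

Lemma fps_mul_poly f g N n : (n < N)%N ->
  fps_mul f g n = ((\poly_(i < N) f i) * (\poly_(i < N) g i))`_n.
Proof.
move=> ltnN; rewrite coefM; apply: eq_bigr => i _; rewrite !coef_poly.
by rewrite (leq_ltn_trans (leq_ord i) ltnN) (leq_ltn_trans (leq_subr _ _) ltnN).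
Qed.

Lemma fps_mulA f g h n :
  fps_mul f (fps_mul g h) n = fps_mul (fps_mul f g) h n.
Proof.
pose P u := \poly_(i < n.+1) u i : {poly A}.
have PE u i : (i <= n)%N -> u i = (P u)`_i by move=> le_in; rewrite coef_poly ltnS le_in.
transitivity ((P f * (P g * P h))`_n).
  rewrite coefM; apply: eq_bigr => i _.
  by rewrite (PE f) ?leq_ord // (@fps_mul_poly _ _ n.+1) // ltnS leq_subr.
rewrite mulrA coefM; apply: eq_bigr => i _.
by rewrite (PE h) ?leq_subr // (@fps_mul_poly _ _ n.+1) // ltn_ord.
Qed.

Lemma fps_divK f g n :
  g 0%N \is a GRing.unit -> fps_mul (fps_div f g) g n = f n.
Proof.
move=> g0; rewrite -fps_mulA /fps_mul big_ord_recr /= subnn.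
rewrite [X in _ * X]fps_mulVf // mulr1 big1 ?add0r // => i _.
by rewrite [X in _ * X]fps_mulVf // subn_eq0 leqNgt ltn_ord mulr0.
Qed.

End FormalSeries.

(* The series of exp(a * t); its coefficients are polynomials in x = 'X. *)
Definition fps_exp (a : {poly rat}) (n : nat) : {poly rat} :=
  (n`!%:R)^-1 *: a ^+ n.

Definition fps_const (c : {poly rat}) (n : nat) : {poly rat} :=
  if n is 0%N then c else 0.

(* 2 * exp(x * t) / (exp(t) + 1) = \sum_n E_n(x) * t^n / n!, as formal power
   series in t over {poly rat}; this determines the E_n since exp(t) + 1 has
   the invertible constant coefficient 2. *)
Definition euler_poly (n : nat) : {poly rat} :=
  n`!%:R *: fps_div (fun k => 2 *: fps_exp 'X k)
                    (fun k => fps_exp 1 k + fps_const 1 k) n.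

Lemma euler_polyP (n : nat) :
  fps_mul (fun k => (k`!%:R)^-1 *: euler_poly k)
          (fun k => fps_exp 1 k + fps_const 1 k) n
  = 2 *: fps_exp 'X n.
Proof.
rewrite -[RHS](fps_divK (fun k => 2 *: fps_exp 'X k)
                        (g := fun k => fps_exp 1 k + fps_const 1 k)).
  apply: eq_bigr => i _; rewrite scalerA mulVf ?scale1r //.
  by rewrite pnatr_eq0 -lt0n fact_gt0.
by rewrite /fps_exp /= fact0 invr1 scale1r expr0 poly_unitE -polyCD size_polyC coefC.
Qed.

(* Main.v *)
Require Import Defs.
From mathcomp Require Import all_boot all_order all_algebra.
From mathcomp Require Import qpoly finfield.
From mathcomp Require Import ring lra zify.
Set Implicit Arguments.
Unset Strict Implicit.
Unset Printing Implicit Defensive.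
Import Order.TTheory GRing.Theory Num.Theory.
Local Open Scope ring_scope.

(** Write p = 2N + 1 and let S be the sum on the left.  Attach a parameter a to
    its summands,

      T(n,a) = C(2n,n) (-1/2)^n prod_(j=1)^n ((2j-1)^2 - a^2)/(j^2 - a^2),
      R(a) = sum_(n=0)^N (3n+1) T(n,a),

    so that R(0) = S [hterm0].  At an odd integer a = 2m + 1 the summands
    T(n,a) with n > m vanish as long as N < a, and a Wilf-Zeilberger telescoping
    gives R(2m+1) = (-1)^m (2m+1) [hsum_odd].

    Multiplying by prod_(j=1)^N (j^2 - a^2) turns R into a polynomial of degree
    at most N in a^2.  It is known at the N + 1 points a = 1, 3, ..., 2N+1: where
    N < a by the evaluation above, and where a <= N because it is 0 there.
    Lagrange interpolation at 0 therefore gives an exact closed formula for S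
    [hsum0_interpolation], with one term for each node a = p - 2i, 0 <= i <= N.

    The term of the node p is (-1)^N p times a quotient of the two products
    prod (1 - p^2/j^2), over j = 1..N, and prod (1 - p^2/q^2), over the odd
    q < p.  Modulo p the q^2 are a rearrangement of the j^2, so this quotient
    is 1 modulo p^3 [leading_ratio].  The term of the node p - 2i, i > 0, is p^3
    times a p-integral number that is congruent to (-1)^(N-i)/(2i^2) when
    2i <= N and is 0 otherwise [reduces_node_term]: one factor p comes from
    j = 2i, and two come from the node p.  Hence

      S = (-1)^N p + (-1)^N (p^3/2) sum_(1 <= i <= N/2) (-1)^i/i^2  (mod p^4).

    On the other side, (-1/p) = (-1)^N, and (2/p) = (-1)^(N - floor(N/2)) by
    Euler's criterion.  Modulo p one has i^(-2) = i^(p-3), and the relation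
    E_n(x+1) + E_n(x) = 2x^n with n = p - 3 evaluates the alternating power sum
    in terms of E_n(floor(N/2) + 1).  Since floor(N/2) + 1 is 1/4 or 3/4 modulo
    p, and E_n(1-x) = E_n(x) for even n, this value is E_n(1/4) modulo p
    [reduces_euler_quarter]. *)

(** * A terminating sum with a free parameter *)

(** Proves a conjunction of disequalities [y != 0], each from a hypothesis
    [x != 0] with y = x or y = - x as ring expressions. *)
Ltac solve_neq0 :=
  repeat (apply/andP; split);
  match goal with
  | h : is_true (?x != 0) |- is_true (?y != 0) =>
      first [exact: h | by rewrite (_ : y = x); [exact: h | ring]
         | by rewrite (_ : y = - x); [rewrite oppr_eq0; exact: h | ring]]
  end.

(** The deformed summand T(n,a), without the factor 3n + 1.  The product index is
    shifted by one, and a vanishing denominator makes its factor 0. *)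
Definition hterm (n : nat) (a : rat) : rat :=
  'C(n.*2, n)%:R * (- (1 / 2)) ^+ n *
  \prod_(0 <= j < n) (((j.*2.+1)%:R ^+ 2 - a ^+ 2) / (j.+1%:R ^+ 2 - a ^+ 2)).

Lemma central_binS (n : nat) :
  (n.+1 * 'C(n.+1.*2, n.+1) = 2 * n.*2.+1 * 'C(n.*2, n))%N.
Proof.
have h1 : ('C(n.+1.*2, n.+1) * (n.+1)`! * (n.+1)`! = (n.+1.*2)`!)%N.
  by rewrite -mulnA -[RHS](@bin_fact n.+1.*2 n.+1) -?addnn ?addnK ?leq_addr.
have h2 : ('C(n.*2, n) * n`! * n`! = (n.*2)`!)%N.
  by rewrite -mulnA -[RHS](@bin_fact n.*2 n) -?addnn ?addnK ?leq_addr.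
move: h1; rewrite doubleS !factS -h2 => h1.
have f0 := fact_gt0 n.
apply/eqP; rewrite -(eqn_pmul2r (m := n.+1 * n`! * n`!)); last by rewrite !muln_gt0 f0.
apply/eqP; move: h1; rewrite -!muln2; move: (n`!) => f; nia.
Qed.

Lemma odd_natr (R : nzSemiRingType) (n : nat) : n.*2.+1%:R = 2 * n%:R + 1 :> R.
Proof. by rewrite -natr1 -mul2n natrM. Qed.

Lemma natr_central_binS (n : nat) :
  'C(n.+1.*2, n.+1)%:R = 2 * (n.*2.+1)%:R * 'C(n.*2, n)%:R / n.+1%:R :> rat.
Proof.
have h : n.+1%:R != 0 :> rat by rewrite pnatr_eq0.
by apply: (mulfI h); rewrite mulrCA divff // mulr1 -!natrM central_binS.
Qed.

Lemma htermS (n : nat) (a : rat) : (n.+1%:R ^+ 2 - a ^+ 2 != 0) ->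
  hterm n.+1 a = - (hterm n a * ((n.*2.+1)%:R / n.+1%:R) *
    (((n.*2.+1)%:R ^+ 2 - a ^+ 2) / (n.+1%:R ^+ 2 - a ^+ 2))).
Proof.
move=> ha; rewrite /hterm big_nat_recr //= natr_central_binS exprS; field.
by rewrite nat1r ha pnatr_eq0.
Qed.

(** At a = 0 the product is C(2n,n)^2 / 4^n. *)
Lemma hterm0 (n : nat) : hterm n 0 = 'C(n.*2, n)%:R ^+ 3 / (-8) ^+ n.
Proof.
elim: n => [|n IHn]; first by rewrite /hterm big_geq // bin0 expr0 !mulr1 expr1n invr1.
have nz : n.+1%:R != 0 :> rat by rewrite pnatr_eq0.
rewrite htermS ?subr0 ?expr0n ?subr0 ?expf_neq0 // IHn (exprS (-8)).
rewrite natr_central_binS.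
have e8 : (-8) ^+ n != 0 :> rat by rewrite expf_neq0.
move: e8 nz; move: (_ ^+ n) (n.+1%:R : rat) (n.*2.+1%:R : rat) ('C(n.*2, n)%:R : rat).
by move=> e x y c e0 x0; field; rewrite e0 x0.
Qed.

(** The ratio T(n,a+2) / T(n,a), cleared of denominators. *)
Lemma hterm_shift (a : rat) (n : nat) :
    (forall j, (j < n)%N -> j.+1%:R ^+ 2 - a ^+ 2 != 0) ->
    (forall j, (j < n)%N -> j.+1%:R ^+ 2 - (a + 2) ^+ 2 != 0) ->
  hterm n (a + 2) *
    (a * (2 * n%:R - 1 - a) * (n%:R + 1 + a) * (n%:R + 2 + a)) =
  - (hterm n a *
     ((2 * n%:R + 1 + a) * (2 + a) * (n%:R - 1 - a) * (n%:R - a))).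
Proof.
elim: n => [|n IHn] h1 h2.
  by rewrite /hterm !big_geq //=; ring.
have {}IHn := IHn (fun j hj => h1 j (ltnW hj)) (fun j hj => h2 j (ltnW hj)).
have {}h1 := h1 n (leqnn _); have {}h2 := h2 n (leqnn _).
rewrite !htermS //.
move: IHn h1 h2; rewrite odd_natr -(natr1 n).
have : n%:R + 1 != 0 :> rat by rewrite natr1 pnatr_eq0.
move: (hterm n (a + 2)) (hterm n a) (n%:R : rat) => t s x hx IHn h1 h2.
have h1' : (x + 1 - a != 0) && (x + 1 + a != 0).
  by rewrite -negb_or -mulf_eq0 -subr_sqr.
have h2' : (x - 1 - a != 0) && (x + 3 + a != 0).
  rewrite -negb_or -mulf_eq0; apply: contra h2 => /eqP E; apply/eqP.
  by rewrite -[RHS]E; ring.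
case/andP: h1' => h11 h12; case/andP: h2' => h21 h22.
transitivity (- ((2 * x + 1) / (x + 1) * ((2 * x + 3 + a) * (2 * x + 1 - a) /
    ((x - 1 - a) * (x + 1 + a)))) *
  (t * (a * (2 * x - 1 - a) * (x + 1 + a) * (x + 2 + a)))).
  by field; solve_neq0.
by rewrite IHn; field; solve_neq0.
Qed.

(** The first n terms of the deformed sum. *)
Definition hsum (n : nat) (a : rat) : rat :=
  \sum_(0 <= i < n) (3 * i + 1)%:R * hterm i a.

(** The Wilf-Zeilberger relation: F(n,a) = (3n+1) T(n,a) satisfies
    F(n,a)/a + F(n,a+2)/(a+2) = G(n+1,a) - G(n,a), where G is the right-hand side
    below and G(0,a) = 0.  The certificate is written with T(n,a+2) rather than
    T(n,a), and the first non-vanishing condition is only asked for j + 1 < n,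
    so that the case n = m + 1, a = 2m + 1 is covered even for m = 0, where the
    factor 1 - a^2 is 0. *)
Lemma hsum_telescope (a : rat) (n : nat) :
    a != 0 -> a + 2 != 0 ->
    (forall j, (j.+1 < n)%N -> j.+1%:R ^+ 2 - a ^+ 2 != 0) ->
    (forall j, (j < n)%N -> j.+1%:R ^+ 2 - (a + 2) ^+ 2 != 0) ->
    (forall j, (j <= n)%N -> j%:R - 1 - a != 0) ->
    (forall j, (j <= n)%N -> 2 * j%:R + 1 + a != 0) ->
  hsum n a / a + hsum n (a + 2) / (a + 2) =
  2 * n%:R * (a + 1) * (n%:R + a + 2) /
    ((a + 2) * (2 * n%:R + 1 + a) * (n%:R - 1 - a)) * hterm n (a + 2).
Proof.
move=> ha ha2.
elim: n => [|n IHn] h1 h2 h3 h4.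
  by rewrite /hsum !big_geq // !(mulr0, mul0r) addr0.
have {}IHn := IHn (fun j hj => h1 j (ltnW hj)) (fun j hj => h2 j (ltnW hj))
  (fun j hj => h3 j (leqW hj)) (fun j hj => h4 j (leqW hj)).
have sh := @hterm_shift a n h1 (fun j hj => h2 j (ltnW hj)).
rewrite /hsum !big_nat_recr //= -!/(hsum _ _) !mulrDl addrACA IHn.
have {}h2 := h2 n (leqnn _).
have h3' := h3 n.+1 (leqnn _); have h4' := h4 n.+1 (leqnn _).
have {}h3 := h3 n (leqnSn _); have {}h4 := h4 n (leqnSn _).
rewrite (htermS h2).
move: {h1} sh h2 h3 h4 h3' h4' {IHn}; rewrite odd_natr natrD natrM -(natr1 n).
have : n%:R + 1 != 0 :> rat by rewrite natr1 pnatr_eq0.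
move: (hterm n (a + 2)) (hterm n a) (n%:R : rat) => t s x hx sh h2 h3 h4 h3' h4'.
have h2' : (x - 1 - a != 0) && (x + 3 + a != 0).
  rewrite -negb_or -mulf_eq0; apply: contra h2 => /eqP E; apply/eqP.
  by rewrite -[RHS]E; ring.
have h5 : x - a != 0 by apply: contra h3' => /eqP E; apply/eqP; rewrite -[RHS]E; ring.
have h6 : 2 * x + 3 + a != 0 by apply: contra h4' => /eqP E; apply/eqP; rewrite -[RHS]E; ring.
case/andP: h2' => h21 h22.
have -> : s = - (t * (a * (2 * x - 1 - a) * (x + 1 + a) * (x + 2 + a))) /
   ((2 * x + 1 + a) * (2 + a) * (x - 1 - a) * (x - a)).
  by rewrite sh opprK mulfK // !mulf_neq0 // addrC.
have h7 : (a + 2) * (2 * x + 3 + a) * (x - a) != 0 by rewrite !mulf_neq0.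
by field; solve_neq0.
Qed.

(** Induction on m: the telescoped sums at a = 2m + 1 and a + 2 have m + 1 terms,
    and the certificate cancels the last term of the sum at a + 2. *)
Lemma hsum_odd (m : nat) : hsum m.+1 m.*2.+1%:R = (-1) ^+ m * m.*2.+1%:R.
Proof.
elim: m => [|m IHm].
  by rewrite /hsum /hterm big_nat1 big_geq // bin0 expr0 !mulr1.
set a : rat := m.*2.+1%:R in IHm *.
have e : m.+1.*2.+1%:R = a + 2 by rewrite /a -natrD addn2 doubleS.
have a0 : a != 0 by rewrite pnatr_eq0.
have a2 : a + 2 != 0 by rewrite -e pnatr_eq0.
have sq (x y : nat) : (x < y)%N -> x%:R ^+ 2 - y%:R ^+ 2 != 0 :> rat.
  by move=> lxy; rewrite subr_eq0 -!natrX eqr_nat; nia.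
have h1 j : (j.+1 < m.+1)%N -> j.+1%:R ^+ 2 - a ^+ 2 != 0.
  by move=> hj; apply: sq; lia.
have h2 j : (j < m.+1)%N -> j.+1%:R ^+ 2 - (a + 2) ^+ 2 != 0.
  by move=> hj; rewrite -e; apply: sq; lia.
have h3 j : (j <= m.+1)%N -> j%:R - 1 - a != 0.
  by move=> hj; rewrite -addrA -opprD subr_eq0 nat1r eqr_nat; lia.
have h4 j : (j <= m.+1)%N -> 2 * j%:R + 1 + a != 0.
  by move=> hj; rewrite -odd_natr -natrD pnatr_eq0.
have := hsum_telescope a0 a2 h1 h2 h3 h4.
rewrite IHm mulfK // => /(canRL (addKr _)) h.
have -> : hsum m.+2 m.+1.*2.+1%:R = hsum m.+1 (a + 2) + (3 * m.+1 + 1)%:R * hterm m.+1 (a + 2).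
  by rewrite /hsum big_nat_recr //= e.
rewrite -[hsum _ _](divfK a2) h e.
have -> : a = 2 * m%:R + 1 by rewrite /a odd_natr.
have := ler0n rat m.
rewrite natrD natrM -(natr1 m) exprS.
move: (hterm _ _) => t; move: (_ ^+ m) (m%:R : rat) => s x x0.
field; repeat (apply/andP; split); lra.
Qed.

(** * Interpolation at odd squares *)

(** The deformed sum of N + 1 terms times the product of the j^2 - a^2 for
    j = 1..N, as a polynomial in the variable X = a^2. *)
Definition hpoly (N : nat) : {poly rat} :=
  \sum_(0 <= n < N.+1) ((3 * n + 1)%:R * ('C(n.*2, n)%:R * (- (1 / 2)) ^+ n)) *:
    (\prod_(0 <= j < n) ((j.*2.+1%:R ^+ 2)%:P - 'X) *
     \prod_(n <= j < N) ((j.+1%:R ^+ 2)%:P - 'X)).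

Lemma size_prod_CsubX (R : idomainType) (c : nat -> R) (r : seq nat) :
  size (\prod_(j <- r) ((c j)%:P - 'X)) = (size r).+1.
Proof.
under eq_bigr => j _ do rewrite -opprB -scaleN1r.
rewrite scaler_prod size_scale ?size_prod_XsubC //.
by rewrite prodf_seq_neq0; apply/allP => j _; rewrite oppr_eq0 oner_eq0.
Qed.

Lemma size_hpoly (N : nat) : (size (hpoly N) <= N.+1)%N.
Proof.
rewrite /hpoly big_mkord; apply: (leq_trans (size_sum _ _ _)).
apply/bigmax_leqP => n _; apply: (leq_trans (size_scale_leq _ _)).
apply: (leq_trans (size_polyMleq _ _)).
rewrite (@size_prod_CsubX _ (fun j => j.*2.+1%:R ^+ 2)).
rewrite (@size_prod_CsubX _ (fun j => j.+1%:R ^+ 2)) !size_iota.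
by have := ltn_ord n; lia.
Qed.

Lemma horner_hpoly (N : nat) (a : rat) :
  (hpoly N).[a ^+ 2] =
  \sum_(0 <= n < N.+1) (3 * n + 1)%:R * ('C(n.*2, n)%:R * (- (1 / 2)) ^+ n) *
    (\prod_(0 <= j < n) (j.*2.+1%:R ^+ 2 - a ^+ 2) *
     \prod_(n <= j < N) (j.+1%:R ^+ 2 - a ^+ 2)).
Proof.
rewrite /hpoly horner_sum; apply: eq_bigr => n _.
rewrite hornerZ hornerM !horner_prod; congr (_ * (_ * _));
  by apply: eq_bigr => j _; rewrite hornerD hornerN hornerC hornerX.
Qed.

Lemma horner_hpoly_hsum (N : nat) (a : rat) :
    (forall j, (j < N)%N -> j.+1%:R ^+ 2 - a ^+ 2 != 0) ->
  (hpoly N).[a ^+ 2] = hsum N.+1 a * \prod_(0 <= j < N) (j.+1%:R ^+ 2 - a ^+ 2).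
Proof.
move=> nz; rewrite horner_hpoly /hsum mulr_suml.
apply: eq_big_nat => n /andP[_ nN].
rewrite /hterm [\prod_(0 <= j < N) _](@big_cat_nat _ _ _ n) //= prodf_div -!mulrA.
do 4!congr (_ * _).
by rewrite mulKf // prodf_seq_neq0; apply/allP => j; rewrite mem_index_iota => jn; apply: nz; lia.
Qed.

(** For 2m + 1 <= N both sides vanish: on the right because of the factor
    j + 1 = 2m + 1, and on the left because every summand contains that factor or
    the factor (2m+1)^2 - X of its first product.  Otherwise no denominator
    vanishes, and the summands beyond m are 0. *)
Lemma horner_hpoly_odd (N m : nat) : (m <= N)%N ->
  (hpoly N).[m.*2.+1%:R ^+ 2] =
  (-1) ^+ m * m.*2.+1%:R * \prod_(0 <= j < N) (j.+1%:R ^+ 2 - m.*2.+1%:R ^+ 2).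
Proof.
move=> mN; have [mN2|Nm2] := leqP m.*2.+1 N.
  have -> : \prod_(0 <= j < N) (j.+1%:R ^+ 2 - m.*2.+1%:R ^+ 2) = 0 :> rat.
    by rewrite (@big_cat_nat _ _ _ m.*2) ?(ltnW mN2) //= [X in _ * X]big_ltn // subrr mul0r mulr0.
  rewrite mulr0 horner_hpoly big1_seq // => n _.
  have [nm|mn] := leqP n m.
    rewrite (@big_cat_nat _ _ _ m.*2 n N) //=; [|lia|lia].
    by rewrite [X in _ * (_ * (_ * X))]big_ltn // subrr mul0r !mulr0.
  rewrite (@big_cat_nat _ _ _ m 0 n) //=; last exact: ltnW.
  by rewrite [X in _ * ((_ * X) * _)]big_ltn // subrr mul0r mulr0 mul0r !mulr0.
have nz j : (j < N)%N -> j.+1%:R ^+ 2 - m.*2.+1%:R ^+ 2 != 0 :> rat.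
  by move=> jN; rewrite subr_eq0 -!natrX eqr_nat; nia.
rewrite horner_hpoly_hsum // -hsum_odd; congr (_ * _).
rewrite /hsum (@big_cat_nat _ _ _ m.+1) //= [X in _ + X]big1_seq ?addr0 //= => n.
rewrite mem_index_iota => /andP[mn nN].
rewrite /hterm (@big_cat_nat _ _ _ m) //=; last exact: ltnW.
by rewrite [X in _ * (_ * (_ * X))]big_ltn // subrr !mul0r !mulr0.
Qed.

(** Lagrange interpolation of [hpoly N] at 1, 9, ..., (2N+1)^2, evaluated at 0. *)
Lemma hsum0_interpolation (N : nat) :
  hsum N.+1 0 =
  \sum_(m < N.+1) (-1) ^+ m * m.*2.+1%:R *
    (\prod_(j < N) ((j.+1%:R ^+ 2 - m.*2.+1%:R ^+ 2) / j.+1%:R ^+ 2) *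
     \prod_(l < N.+1 | l != m)
        (l.*2.+1%:R ^+ 2 / (l.*2.+1%:R ^+ 2 - m.*2.+1%:R ^+ 2))).
Proof.
have nz : \prod_(j < N) j.+1%:R ^+ 2 != 0 :> rat.
  by apply/prodf_neq0 => j _; rewrite expf_neq0 // pnatr_eq0.
apply: (mulIf nz).
have := @horner_hpoly_hsum N 0.
rewrite expr0n mulr0n big_mkord; under eq_bigr => j _ do rewrite subr0.
move=> <-; last by move=> j _; rewrite subr0 expf_neq0 // pnatr_eq0.
pose x (l : nat) : rat := l.*2.+1%:R ^+ 2.
have x_inj : injective x.
  by move=> l m /eqP; rewrite /x -!natrX eqr_nat => /eqP; nia.
rewrite {1}(lagrange_gen (ltn0Sn N) x_inj (size_hpoly N)).
rewrite horner_sum mulr_suml; apply: eq_bigr => m _.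
rewrite hornerM hornerC horner_hpoly_odd -1?ltnS // lagrangeE // hornerM hornerC.
rewrite !horner_prod big_mkord.
have -> : \prod_(l < N.+1 | l != m)
    (l.*2.+1%:R ^+ 2 / (l.*2.+1%:R ^+ 2 - m.*2.+1%:R ^+ 2)) =
  (\prod_(l < N.+1 | l != m) ('X - (x l)%:P).[x m])^-1 *
  \prod_(l < N.+1 | l != m) ('X - (x l)%:P).[0].
  rewrite mulrC -prodf_div; apply: eq_bigr => l _.
  by rewrite !hornerXsubC sub0r -/(x l) -/(x m) -[x m - x l]opprB invrN mulrNN.
rewrite prodf_div -!mulrA; do 3!congr (_ * _).
by rewrite [RHS]mulrC -!mulrA divff // mulr1.
Qed.

(** For p = 2N + 1 and i < N, this is p - 2(i+1). *)
Definition node (N i : nat) : nat := (N - i.+1).*2.+1.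

(** The interpolation term of the node q = p - 2(i+1), where p = 2N + 1; the
    factor that comes from the node p is kept apart. *)
Definition node_term (N : nat) (i : 'I_N) : rat :=
  let q : rat := (node N i)%:R in
  (-1) ^+ (N - i.+1) * q *
  (\prod_(j < N) ((j.+1%:R ^+ 2 - q ^+ 2) / j.+1%:R ^+ 2) *
   (N.*2.+1%:R ^+ 2 / (N.*2.+1%:R ^+ 2 - q ^+ 2) *
    \prod_(l < N | l != i) ((node N l)%:R ^+ 2 / ((node N l)%:R ^+ 2 - q ^+ 2)))).

(** The interpolation formula with the node 2N + 1 split off and the remaining
    ones listed in decreasing order. *)
Lemma hsum0_nodes (N : nat) :
  hsum N.+1 0 =
  (-1) ^+ N * N.*2.+1%:R *
    (\prod_(j < N) (1 - N.*2.+1%:R ^+ 2 / j.+1%:R ^+ 2) /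
     \prod_(l < N) (1 - N.*2.+1%:R ^+ 2 / (node N l)%:R ^+ 2)) +
  \sum_(i < N) node_term i.
Proof.
rewrite hsum0_interpolation big_ord_recr /= addrC; congr (_ + _).
  congr (_ * _); congr (_ * _).
    by apply: eq_bigr => j _; rewrite mulrBl divff // expf_neq0 ?pnatr_eq0.
  rewrite big_mkcond big_ord_recr /= eqxx mulr1 (reindex_inj rev_ord_inj) /= -prodfV.
  apply: eq_bigr => l _; rewrite -val_eqE /= -/(node N l).
  have -> : (N - l.+1 != N)%N by have := ltn_ord l; lia.
  have q0 : (node N l)%:R != 0 :> rat by rewrite pnatr_eq0.
  rewrite -invf_div; congr (_^-1).
  by rewrite mulrBl divff ?expf_neq0.
rewrite (reindex_inj rev_ord_inj) /=; apply: eq_bigr => i _.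
rewrite /node_term -/(node N i); congr (_ * (_ * _)).
rewrite big_mkcond big_ord_recr /= mulrC -val_eqE /=.
have -> : (N != N - i.+1)%N by have := ltn_ord i; lia.
congr (_ * _).
rewrite -big_mkcond (reindex_inj rev_ord_inj) /=.
apply: eq_bigl => l; rewrite -!val_eqE /=.
by have := ltn_ord i; have := ltn_ord l; lia.
Qed.

(** * Euler polynomials *)

Lemma euler_poly_rec (n : nat) :
  \sum_(k < n.+1) 'C(n, k)%:R *: euler_poly k + euler_poly n = 2 *: 'X^n.
Proof.
have f0 k : k`!%:R != 0 :> rat by rewrite pnatr_eq0 -lt0n fact_gt0.
have <- : n`!%:R *: (2 *: fps_exp 'X n) = 2 *: 'X^n.
  by rewrite /fps_exp !scalerA mulrAC divff // mul1r.
rewrite -euler_polyP /fps_mul /fps_exp.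
under [in RHS]eq_bigr => k _ do rewrite mulrDr.
rewrite big_split /= scalerDr; congr (_ + _).
  rewrite scaler_sumr; apply: eq_bigr => k _.
  rewrite expr1n -scalerAl -scalerAr mulr1 !scalerA; congr (_ *: _).
  have kn : (k <= n)%N by rewrite -ltnS.
  by rewrite -(bin_fact kn) !natrM; field; rewrite !f0.
rewrite big_ord_recr /= subnn /= mulr1 big1 ?add0r => [|k _].
  by rewrite scalerA divff // scale1r.
by rewrite /fps_const; case: (n - k)%N (subn_gt0 k n) => [|m]; rewrite ?mulr0 // ltn_ord.
Qed.

Lemma euler_rec_uniq (f g : nat -> {poly rat}) :
    (forall n, \sum_(k < n.+1) 'C(n, k)%:R *: f k + f n =
               \sum_(k < n.+1) 'C(n, k)%:R *: g k + g n) ->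
  forall n, f n = g n.
Proof.
move=> fg; elim/ltn_ind => n IHn; have := fg n.
rewrite !big_ord_recr /= binn !scale1r.
under eq_bigr => k _ do rewrite IHn //.
rewrite -!addrA => /addrI; rewrite -!mulr2n -!scaler_nat => /(congr1 (fun q => 2^-1 *: q)).
by rewrite !scalerA mulVf // !scale1r.
Qed.

(** The polynomials E_n(X+1) and 2 X^n - E_n(X) satisfy the same recurrence, which
    has only one solution. *)
Lemma euler_poly_shift (n : nat) :
  euler_poly n \Po ('X + 1) + euler_poly n = 2 *: 'X^n.
Proof.
apply/(canLR (subrK _)); move: n; apply: euler_rec_uniq => n.
have comp_rec : (\sum_(k < n.+1) 'C(n, k)%:R *: euler_poly k + euler_poly n) \Po ('X + 1) =
    2 *: ('X + 1) ^+ n by rewrite euler_poly_rec comp_polyZ comp_Xn_poly.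
transitivity (2 *: ('X + 1 : {poly rat}) ^+ n).
  rewrite -comp_rec comp_polyD raddf_sum /=; congr (_ + _).
  by apply: eq_bigr => k _; rewrite comp_polyZ.
under [in RHS]eq_bigr => k _ do rewrite scalerBr.
rewrite sumrB addrACA -opprD euler_poly_rec addrK.
rewrite addrC exprDn scaler_sumr; apply: eq_bigr => k _.
by rewrite expr1n mul1r -scaler_nat !scalerA mulrC.
Qed.

(** Compare leading coefficients: a polynomial and its shift have the same one. *)
Lemma comp_poly_shift_anti (f : {poly rat}) : f \Po ('X + 1) = - f -> f = 0.
Proof.
move=> /(congr1 lead_coef).
rewrite lead_coef_comp ?size_XaddC // lead_coefN lead_coefXaddC expr1n mulr1.
move/eqP; rewrite -addr_eq0 -mulr2n -mulr_natr mulf_eq0 pnatr_eq0 orbF.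
by rewrite lead_coef_eq0 => /eqP.
Qed.

(** Both sides solve f(X+1) + f(X) = 2 (-1)^n X^n, whose solution is unique by
    [comp_poly_shift_anti]. *)
Lemma euler_poly_sym (n : nat) : euler_poly n \Po (1 - 'X) = (-1) ^+ n *: euler_poly n.
Proof.
have e1 : (1 - 'X) \Po ('X + 1) = - 'X :> {poly rat}.
  by rewrite comp_polyB comp_polyX -polyC1 comp_polyC opprD addrCA subrr addr0.
have e2 : ('X + 1) \Po (- 'X) = 1 - 'X :> {poly rat}.
  by rewrite comp_polyD comp_polyX -polyC1 comp_polyC addrC.
move: (euler_poly n) (euler_poly_shift n) => E E_shift.
have := congr1 (comp_poly (- 'X)) E_shift.
rewrite comp_polyD comp_polyZ comp_Xn_poly -comp_polyA e2 => h.
apply/subr0_eq/comp_poly_shift_anti; rewrite comp_polyB comp_polyZ -comp_polyA e1.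
rewrite (canRL (addrK _) E_shift) (canRL (addKr _) h).
rewrite -[in (- 'X) ^+ n]scaleN1r exprZn scalerBr scalerA mulrC -scalerA.
by rewrite opprB -addrA [in X in - _ + X]addrC subrK addrC opprB.
Qed.

Lemma euler_poly0 (n : nat) : ~~ odd n -> (0 < n)%N -> (euler_poly n).[0] = 0.
Proof.
move=> n_even n_gt0; have := congr1 (horner^~ 0) (euler_poly_shift n).
have := congr1 (horner^~ 0) (euler_poly_sym n).
move: (euler_poly n) => E.
rewrite !(hornerD, horner_comp, hornerZ, hornerN, hornerX, hornerXn, hornerC, horner_exp).
rewrite add0r subr0 -signr_odd (negbTE n_even) mul1r => ->.
by rewrite expr0n eqn0Ngt n_gt0 mulr0 -mulr2n => /eqP; rewrite mulrn_eq0 => /eqP.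
Qed.

Lemma euler_poly_alt_sum (n M : nat) : ~~ odd n -> (0 < n)%N ->
  \sum_(k < M) (-1) ^+ k * k%:R ^+ n = - ((-1) ^+ M * (euler_poly n).[M%:R] / 2).
Proof.
move=> n_even n_gt0; elim: M => [|M IHM].
  by rewrite big_ord0 euler_poly0 // mulr0 mul0r oppr0.
have := congr1 (horner^~ M%:R) (euler_poly_shift n).
rewrite big_ord_recr /= IHM.
move: (euler_poly n) => E.
rewrite !(hornerD, horner_comp, hornerZ, hornerN, hornerX, hornerXn, hornerC) natr1 exprS.
by move=> /(canRL (addrK _)) ->; field.
Qed.

(** * Reduction of rational numbers into a field *)

Section Reduction.
Variable F : fieldType.
Implicit Types (x y : rat) (u v : F).

(** The rational x has image u in F: its reduced denominator is not 0 in F, and u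
    is the quotient of the images of its numerator and denominator.  For F = 'F_p
    this says that x is p-integral with residue class u. *)
Definition reduces x u := (denq x)%:~R != 0 :> F /\ ratr x = u.

Lemma reduces_frac (a b : int) : b%:~R != 0 :> F ->
  reduces (a%:~R / b%:~R) (a%:~R / b%:~R).
Proof.
case: divqP => [|k x k0]; first by rewrite eqxx.
rewrite rmorphM mulf_eq0 negb_or => /andP[k0F d0]; split => //.
by rewrite /ratr rmorphM -mulf_div divff // mul1r.
Qed.

Lemma reducesP x u : reduces x u ->
  exists a b : int, [/\ b%:~R != 0 :> F, x = a%:~R / b%:~R & u = a%:~R / b%:~R].
Proof. by case=> d0 <-; exists (numq x), (denq x); rewrite divq_num_den. Qed.

Let rat_neq0 (b : int) : b%:~R != 0 :> F -> b%:~R != 0 :> rat.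
Proof. by apply: contra; rewrite intr_eq0 => /eqP ->. Qed.

Lemma reduces_int (a : int) : reduces a%:~R a%:~R.
Proof. by have := @reduces_frac a 1; rewrite !divr1; apply; rewrite oner_eq0. Qed.

Lemma reduces_nat (n : nat) : reduces n%:R n%:R.
Proof. exact: (reduces_int n). Qed.

Lemma reducesD x y u v : reduces x u -> reduces y v -> reduces (x + y) (u + v).
Proof.
move=> /reducesP[a [b [b0 -> ->]]] /reducesP[c [d [d0 -> ->]]].
rewrite !addf_div ?rat_neq0 // -!rmorphM -!rmorphD.
by apply: reduces_frac; rewrite rmorphM mulf_neq0.
Qed.

Lemma reducesM x y u v : reduces x u -> reduces y v -> reduces (x * y) (u * v).
Proof.
move=> /reducesP[a [b [b0 -> ->]]] /reducesP[c [d [d0 -> ->]]].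
rewrite !mulf_div -!rmorphM.
by apply: reduces_frac; rewrite rmorphM mulf_neq0.
Qed.

Lemma reducesN x u : reduces x u -> reduces (- x) (- u).
Proof. by rewrite -mulN1r -[- u]mulN1r; apply: reducesM; apply: (reduces_int (-1)). Qed.

Lemma reducesB x y u v : reduces x u -> reduces y v -> reduces (x - y) (u - v).
Proof. by move=> xu yv; apply: reducesD => //; apply: reducesN. Qed.

Lemma reducesV x u : reduces x u -> u != 0 -> reduces x^-1 u^-1.
Proof.
move=> /reducesP[a [b [b0 -> ->]]]; rewrite mulf_eq0 negb_or => /andP[a0 _].
by rewrite !invf_div; apply: reduces_frac.
Qed.

Lemma reduces0M x y v : reduces x 0 -> reduces y v -> reduces (x * y) 0.
Proof. by move=> x0 yv; rewrite -(mul0r v); apply: reducesM. Qed.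

Lemma reducesB0 x y u : reduces x u -> reduces y 0 -> reduces (x - y) u.
Proof. by move=> xu y0; rewrite -(subr0 u); apply: reducesB. Qed.

Lemma reduces_neq0 x u : reduces x u -> u != 0 -> x != 0.
Proof.
case=> _ <-; apply: contra => /eqP ->.
by rewrite /ratr (_ : numq 0 = 0) // mul0r.
Qed.

Lemma reduces_div x y u v : reduces x u -> reduces y v -> v != 0 ->
  reduces (x / y) (u / v).
Proof. by move=> xu yv v0; apply: reducesM => //; apply: reducesV. Qed.

Lemma reducesX x u n : reduces x u -> reduces (x ^+ n) (u ^+ n).
Proof.
move=> xu; elim: n => [|n IHn]; first exact: (reduces_nat 1).
by rewrite !exprS; apply: reducesM.
Qed.

Lemma reduces_sum (I : Type) (r : seq I) (P : pred I) (f : I -> rat) (g : I -> F) :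
    (forall i, P i -> reduces (f i) (g i)) ->
  reduces (\sum_(i <- r | P i) f i) (\sum_(i <- r | P i) g i).
Proof.
by move=> fg; apply: big_rec2 => [|i y x Pi]; [apply: (reduces_nat 0) | apply/reducesD/fg].
Qed.

Lemma reduces_prod (I : Type) (r : seq I) (P : pred I) (f : I -> rat) (g : I -> F) :
    (forall i, P i -> reduces (f i) (g i)) ->
  reduces (\prod_(i <- r | P i) f i) (\prod_(i <- r | P i) g i).
Proof.
by move=> fg; apply: big_rec2 => [|i y x Pi]; [apply: (reduces_nat 1) | apply/reducesM/fg].
Qed.

(** The coefficients of the Euler polynomials have powers of 2 as
    denominators. *)
Lemma reduces_euler_poly (n : nat) : 2 != 0 :> F ->
  exists g : {poly F}, forall i, reduces (euler_poly n)`_i g`_i.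
Proof.
move=> F2; elim/ltn_ind: n => n IHn.
have [g gP] : exists g : nat -> {poly F},
    forall k, (k < n)%N -> forall i, reduces (euler_poly k)`_i (g k)`_i.
  elim: n IHn => [|n IHn] H; first by exists (fun=> 0).
  have [g gP] := IHn (fun k kn => H k (ltnW kn)).
  have [h hP] := H n (ltnSn n).
  exists (fun k => if (k < n)%N then g k else h) => k; rewrite ltnS => kn.
  by case: ltnP => [/gP //|nk]; have -> : k = n by apply/eqP; rewrite eqn_leq kn.
exists (2^-1 *: (2 *: 'X^n - \sum_(k < n) 'C(n, k)%:R *: g k)) => i.
have -> : euler_poly n =
    2^-1 *: (2 *: 'X^n - \sum_(k < n) 'C(n, k)%:R *: euler_poly k).
  rewrite -euler_poly_rec big_ord_recr /= binn scale1r.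
  have aux (V : zmodType) (a b : V) : a + b + b - a = b *+ 2.
    by rewrite -addrA addrC addrA subrK.
  rewrite aux -scaler_nat scalerA.
  by rewrite mulVf // scale1r.
rewrite !(coefZ, coefB, coefXn, coef_sum); apply: reducesM.
  by apply: reducesV => //; apply: reduces_nat.
apply: reducesB; first by apply: reducesM; apply: reduces_nat.
apply: reduces_sum => k _; rewrite coefZ [X in reduces _ X]coefZ; apply: reducesM.
  exact: reduces_nat.
exact: (gP k (ltn_ord k)).
Qed.

Lemma reduces_horner (f : {poly rat}) (g : {poly F}) x u :
  (forall i, reduces f`_i g`_i) -> reduces x u -> reduces f.[x] g.[u].
Proof.
move=> fg xu; rewrite (horner_coef_wide x (leq_maxl (size f) (size g))).
rewrite (horner_coef_wide u (leq_maxr (size f) (size g))).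
by apply: reduces_sum => i _; apply: reducesM; last exact: reducesX.
Qed.

End Reduction.

(** A p-integral number congruent to 0 remains p-integral when divided by p. *)
Lemma reduces0P (p : nat) (x : rat) : prime p -> reduces x (0 : 'F_p) ->
  coprime `|denq (x / p%:R)| p.
Proof.
move=> p_pr [d0 /eqP]; rewrite /ratr mulf_eq0 invr_eq0 (negbTE d0) orbF => n0.
move: d0 n0; rewrite -!(dvdz_pcharf (pchar_Fp p_pr)) => d0 /dvdzP[k nk].
rewrite -[x]divq_num_den nk rmorphM /= mulrAC mulfK ?pnatr_eq0 -?lt0n ?prime_gt0 //.
rewrite coprime_sym prime_coprime //; apply: contra d0.
case: (divqP k (denq x)) => [|l y l0]; first by rewrite dvdz0.
by move=> h; rewrite dvdz_mull.
Qed.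

(** * Squares and quadratic characters modulo an odd prime *)

(** On {1, ..., N}, the map sending j to 2j when 2j <= N and to 2N + 1 - 2j
    otherwise; arguments and values are shifted down by one to lie in 'I_N. *)
Definition fold_dbl_nat (N j : nat) : nat :=
  if (j.+1.*2 <= N)%N then j.*2.+1 else (N - j.+1).*2.

Lemma fold_dbl_subproof (N : nat) (j : 'I_N) : (fold_dbl_nat N j < N)%N.
Proof. by rewrite /fold_dbl_nat; have := ltn_ord j; case: (leqP j.+1.*2 N); lia. Qed.

Definition fold_dbl (N : nat) (j : 'I_N) : 'I_N := Ordinal (fold_dbl_subproof j).

Lemma fold_dbl_inj (N : nat) : injective (@fold_dbl N).
Proof.
move=> i j /(congr1 val); rewrite /= /fold_dbl_nat => h; apply: val_inj => /=.
move: h; have := ltn_ord i; have := ltn_ord j.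
by case: (leqP i.+1.*2 N); case: (leqP j.+1.*2 N); lia.
Qed.

Section ModularArithmetic.
Variables (p N : nat).
Hypotheses (p_pr : prime p) (pE : p = N.*2.+1).

Lemma Fp_eqr_nat (m n : nat) : (m%:R == n%:R :> 'F_p) = (m == n %[mod p]).
Proof. by rewrite -val_eqE /= !val_Fp_nat. Qed.

Lemma Fp_natr_neq0 (n : nat) : (0 < n < p)%N -> n%:R != 0 :> 'F_p.
Proof.
move=> /andP[n0 np]; rewrite -[0]/(0%:R) Fp_eqr_nat mod0n modn_small //.
by rewrite -lt0n.
Qed.

Lemma Fp_sqr_inj (i j : nat) : (0 < i <= N)%N -> (0 < j <= N)%N ->
  i%:R ^+ 2 = j%:R ^+ 2 :> 'F_p -> i = j.
Proof.
move=> iN jN /eqP; rewrite eqf_sqr => /orP[|].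
  by rewrite Fp_eqr_nat !modn_small; lia.
have ij : (0 < i + j < p)%N by lia.
by rewrite -addr_eq0 -natrD (negbTE (Fp_natr_neq0 ij)).
Qed.

(** Modulo p = 2N + 1 the folding map is doubling up to sign. *)
Lemma fold_dblE (j : 'I_N) :
  (fold_dbl j).+1%:R = (-1) ^+ (N < j.+1.*2)%N * (j.+1.*2)%:R :> 'F_p.
Proof.
rewrite /= /fold_dbl_nat; have jN := ltn_ord j; case: leqP => _.
  by rewrite mul1r doubleS.
rewrite expr1 mulN1r; apply/eqP; rewrite -addr_eq0 -natrD -[0]/(0%:R) Fp_eqr_nat.
by rewrite mod0n (_ : (_ + _)%N = p) ?modnn // pE; lia.
Qed.

(** Modulo p the squares of 1, ..., N and of 2, 4, ..., 2N are the same, each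
    listed once. *)
Lemma big_fold_dbl (R : Type) (idx : R) (op : Monoid.com_law idx) (h : 'F_p -> R) :
  \big[op/idx]_(j < N) h (j.+1%:R ^+ 2) = \big[op/idx]_(j < N) h ((j.+1.*2)%:R ^+ 2).
Proof.
rewrite (reindex_inj (@fold_dbl_inj N)) /=; apply: eq_bigr => j _.
by rewrite fold_dblE exprMn -exprM mulnC exprM sqrrN expr1n expr1n mul1r.
Qed.

(** Gauss's argument: doubling permutes 1, ..., N up to sign, and the sign is
    negative for the N - floor(N/2) values j with 2j > N. *)
Lemma Fp_exp2_half : 2 ^+ N = (-1) ^+ (N - N./2) :> 'F_p.
Proof.
have f0 : \prod_(j < N) j.+1%:R != 0 :> 'F_p.
  by apply/prodf_neq0 => j _; apply: Fp_natr_neq0; have := ltn_ord j; lia.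
apply: (mulIf f0).
rewrite -[N in 2 ^+ N]card_ord -prodrMl.
under eq_bigr => j _ do rewrite -natrM mul2n.
rewrite [in RHS](reindex_inj (@fold_dbl_inj N)) /=.
under [in RHS]eq_bigr => j _ do rewrite fold_dblE.
rewrite big_split /= mulrA; set s := (X in X * _).
suff -> : s = 1 by rewrite mul1r.
rewrite /s prodrXr -exprD -signr_odd.
have -> : (\sum_(j < N) (N < j.+1.*2) = N - N./2)%N; last by rewrite addnn odd_double.
rewrite -(big_mkord xpredT (fun j => (N < j.+1.*2)%N : nat)).
rewrite (@big_cat_nat _ _ _ N./2) //=; last by lia.
rewrite big_nat big1 => [|j jN]; last by case: ltnP; lia.
rewrite big_nat (eq_bigr (fun=> 1%N)) => [|j jN]; last by case: ltnP; lia.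
by rewrite -big_nat sum_nat_const_nat muln1.
Qed.

Lemma Fp_exp_pred (x : 'F_p) : x != 0 -> x ^+ N.*2 = 1.
Proof.
move=> x0; apply: (mulfI x0); rewrite -exprS mulr1 -pE.
by have := expf_card x; rewrite card_Fp.
Qed.

Lemma Fp_euler_criterion (a : int) : a%:~R != 0 :> 'F_p ->
  (legendre a p)%:~R = a%:~R ^+ N :> 'F_p.
Proof.
move=> a0; rewrite /legendre (dvdz_pcharf (pchar_Fp p_pr)) (negbTE a0).
have dvdE (r : nat) : (p %| r%:Z ^+ 2 - a)%Z = (r%:R ^+ 2 == a%:~R :> 'F_p).
  by rewrite (dvdz_pcharf (pchar_Fp p_pr)) rmorphB rmorphXn subr_eq0.
case: existsP => [[r]|nsq].
  rewrite dvdE => /eqP rE; rewrite -rE -exprM mul2n Fp_exp_pred //.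
  by apply: contra a0; rewrite -rE => /eqP ->; rewrite expr0n.
have : a%:~R ^+ N == 1 :> 'F_p \/ a%:~R ^+ N == -1 :> 'F_p.
  by apply/orP; rewrite -sqrf_eq1 -exprM muln2 Fp_exp_pred.
case=> /eqP aN //; exfalso.
(* If a were a non-square with a^N = 1, then X^N - 1 would have the root a besides
   the N distinct squares 1, 4, ..., N^2. *)
pose rs := a%:~R :: [seq j.+1%:R ^+ 2 : 'F_p | j <- iota 0 N].
have N0 : (0 < N)%N by move: p_pr; rewrite pE; case: (N).
have pol0 : 'X^N - 1 != 0 :> {poly 'F_p} by rewrite -size_poly_eq0 size_XnsubC.
have : (size rs < size ('X^N - 1 : {poly 'F_p})%R)%N.
  apply: max_poly_roots => //.
    apply/allP => x; rewrite inE rootE !hornerE /= => /predU1P[->|/mapP[j]].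
      by rewrite aN subrr.
    rewrite mem_iota => jN ->; rewrite -exprM mul2n Fp_exp_pred ?subrr //.
    by apply: Fp_natr_neq0; lia.
  rewrite /= map_inj_in_uniq ?iota_uniq ?andbT; last first.
    move=> i j; rewrite !mem_iota => iN jN /Fp_sqr_inj h.
    by apply/eq_add_S/h; lia.
  apply/negP => /mapP[j]; rewrite mem_iota => jN aE; apply: nsq.
  have jp : (j.+1 < p)%N by lia.
  by exists (Ordinal jp); rewrite dvdE aE.
by rewrite size_XnsubC //= size_map size_iota ltnn.
Qed.

Lemma legendreN1 : (2 < p)%N -> legendre (-1) p = (-1) ^+ N.
Proof.
move=> p2; have N10 : (-1)%:~R != 0 :> 'F_p by rewrite rmorphN1 oppr_eq0 oner_eq0.
have := Fp_euler_criterion N10; rewrite rmorphN1 -signr_odd -[in RHS]signr_odd.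
have n1 : 1 != -1 :> 'F_p by rewrite -addr_eq0; apply: (@Fp_natr_neq0 2); lia.
rewrite /legendre (dvdz_pcharf (pchar_Fp p_pr)) (negbTE N10).
case: ifP => _; case: (odd N) => //= /eqP; rewrite ?expr1 ?expr0 ?(negbTE n1) //.
by rewrite eq_sym (negbTE n1).
Qed.

Lemma Fp_legendre2 : (2 < p)%N -> (legendre 2 p)%:~R = (-1) ^+ (N - N./2) :> 'F_p.
Proof.
move=> p2; rewrite Fp_euler_criterion; first exact: Fp_exp2_half.
by apply: (@Fp_natr_neq0 2); lia.
Qed.

End ModularArithmetic.

(** * The interpolation formula modulo the fourth power of p *)

Section PadicEstimates.
Variables (p N : nat).
Hypotheses (p_pr : prime p) (pE : p = N.*2.+1) (p_gt3 : (3 < p)%N).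

Let red0p : reduces p%:R (0 : 'F_p).
Proof. by rewrite -(pchar_Fp_0 p_pr); apply: reduces_nat. Qed.

Lemma reduces_node (i : nat) : (i < N)%N ->
  reduces (node N i)%:R (- (i.+1.*2)%:R : 'F_p).
Proof.
move=> iN; have -> : (node N i)%:R = p%:R - (i.+1.*2)%:R :> rat.
  by apply/(canRL (addrK _)); rewrite -natrD; congr (_%:R); rewrite /node; lia.
by rewrite -[X in reduces _ X]sub0r; apply: reducesB => //; apply: reduces_nat.
Qed.

(** First-order expansion of a product of factors 1 - c f_i with c congruent to 0
    modulo p; the remainder is absorbed in y. *)
Lemma prod_one_sub (I : Type) (r : seq I) (f : I -> rat) (g : I -> 'F_p) (c : rat) :
    reduces c (0 : 'F_p) -> (forall i, reduces (f i) (g i)) ->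
  exists2 y, \prod_(i <- r) (1 - c * f i) = 1 - c * y & reduces y (\sum_(i <- r) g i).
Proof.
move=> c0 fg; elim: r => [|i r [y yE yr]].
  by exists 0; [rewrite big_nil mulr0 subr0 | rewrite big_nil; apply: (reduces_nat _ 0)].
exists (f i + y - c * (f i * y)); first by rewrite big_cons yE; ring.
rewrite big_cons; apply: reducesB0; first exact: reducesD.
by apply: reduces0M c0 _; apply: reducesM yr.
Qed.

(** The quotient is 1 modulo p^3: both products are 1 - p^2 y with y p-integral,
    and [big_fold_dbl] shows that the two values of y agree modulo p. *)
Lemma leading_ratio :
  exists2 z, \prod_(j < N) (1 - p%:R ^+ 2 / j.+1%:R ^+ 2) /
     \prod_(l < N) (1 - p%:R ^+ 2 / (node N l)%:R ^+ 2) = 1 + p%:R ^+ 2 * z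
   & reduces z (0 : 'F_p).
Proof.
have P0 : reduces (p%:R ^+ 2) (0 : 'F_p) by rewrite expr2; apply: reduces0M red0p red0p.
have red1 (j : 'I_N) : reduces (j.+1%:R ^+ 2)^-1 ((j.+1%:R ^+ 2)^-1 : 'F_p).
  apply: reducesV; first by apply/reducesX/reduces_nat.
  by rewrite expf_neq0 // Fp_natr_neq0 //; have := ltn_ord j; lia.
have red2 (j : 'I_N) : reduces ((node N j)%:R ^+ 2)^-1 ((((j.+1.*2)%:R : 'F_p) ^+ 2)^-1).
  rewrite -[in X in reduces _ X]sqrrN; apply: reducesV; first exact/reducesX/reduces_node.
  by rewrite sqrrN expf_neq0 // Fp_natr_neq0 //; have := ltn_ord j; lia.
have [y yE yr] := prod_one_sub (index_enum _) P0 red1.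
have [w wE wr] := prod_one_sub (index_enum _) P0 red2.
have w1 : reduces (1 - p%:R ^+ 2 * w) (1 : 'F_p).
  by apply: reducesB0; [apply: (reduces_nat _ 1) | apply: reduces0M P0 wr].
have w1_neq0 : 1 - p%:R ^+ 2 * w != 0.
  by apply: reduces_neq0 w1 _; apply: oner_neq0.
exists ((w - y) / (1 - p%:R ^+ 2 * w)).
  by rewrite yE wE; field.
apply: reduces0M; last by apply: reducesV w1 _; apply: oner_neq0.
rewrite (big_fold_dbl p_pr pE _ (fun x => x^-1)) in yr.
by rewrite -(subrr (\sum_(j < N) (((j.+1.*2)%:R : 'F_p) ^+ 2)^-1)); apply: reducesB.
Qed.

Lemma Fp_dbl_sqr_eq (i l : 'I_N) :
  ((l.+1.*2)%:R ^+ 2 == (i.+1.*2)%:R ^+ 2 :> 'F_p) = (l == i).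
Proof.
apply/eqP/eqP => [|-> //]; rewrite -!mul2n !natrM !exprMn => /mulfI h.
apply/val_inj/eq_add_S/(Fp_sqr_inj p_pr pE).
- by rewrite /= ltn_ord.
- by rewrite /= ltn_ord.
by apply: h; rewrite expf_neq0 // (@Fp_natr_neq0 p p_pr 2); lia.
Qed.

(** Both products run over the nonzero squares of 'F_p other than S, with
    mutually inverse factors. *)
Lemma Fp_punctured_ratio (i j0 : 'I_N) : j0.+1 = i.+1.*2 ->
  let S : 'F_p := (i.+1.*2)%:R ^+ 2 in
  \prod_(j < N | j != j0) ((j.+1%:R ^+ 2 - S) / j.+1%:R ^+ 2) *
  \prod_(l < N | l != i) ((l.+1.*2)%:R ^+ 2 / ((l.+1.*2)%:R ^+ 2 - S)) = 1.
Proof.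
move=> j0E S; pose h (x : 'F_p) := if x == S then 1 else (x - S) / x.
have -> : \prod_(j < N | j != j0) ((j.+1%:R ^+ 2 - S) / j.+1%:R ^+ 2) =
          \prod_(j < N) h (j.+1%:R ^+ 2).
  rewrite big_mkcond; apply: eq_bigr => j _; rewrite /h /S -j0E.
  have -> : (j.+1%:R ^+ 2 == j0.+1%:R ^+ 2 :> 'F_p) = (j == j0).
    apply/eqP/eqP => [e|-> //]; apply/val_inj/eq_add_S/(Fp_sqr_inj p_pr pE) => //.
    - by rewrite /= ltn_ord.
    - by rewrite /= ltn_ord.
  by case: eqP.
rewrite (big_fold_dbl p_pr pE) [X in _ * X]big_mkcond -big_split big1 // => l _ /=.
rewrite /h /S Fp_dbl_sqr_eq; case: eqP => [_|/eqP li] /=; first by rewrite mulr1.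
rewrite mulf_div [X in _ / X]mulrC divff // mulf_neq0 //.
  by rewrite subr_eq0 Fp_dbl_sqr_eq.
by rewrite expf_neq0 // Fp_natr_neq0 //; have := ltn_ord l; lia.
Qed.

(** Write s = 2(i+1) and q = p - s.  The factor j + 1 = s of the first product
    contributes (s^2 - q^2)/s^2 = p (s - q)/s^2, and the node p contributes
    p^2/(p^2 - q^2); what remains is 1 modulo p.  For s > N the first product
    contains the factor j + 1 = q, which is 0. *)
Lemma reduces_node_term (i : 'I_N) :
  exists2 z, node_term i = p%:R ^+ 3 * z
  & reduces z (if (i < N./2)%N then (-1) ^+ (N - i.+1) / (2 * i.+1%:R ^+ 2) else 0 : 'F_p).
Proof.
have iN := ltn_ord i; case: ltnP => iN2; last first.
  exists 0; last exact: (reduces_nat _ 0).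
  rewrite mulr0 /node_term.
  have jN : ((N - i.+1).*2 < N)%N by lia.
  by rewrite (bigD1 (Ordinal jN)) //= subrr !mul0r mulr0.
(* The index of the factor divisible by p: j0 + 1 = 2(i+1). *)
have jN : (i.*2.+1 < N)%N by lia.
pose j0 : 'I_N := Ordinal jN.
have j0E : j0.+1 = i.+1.*2 by rewrite /= doubleS.
have UV := Fp_punctured_ratio j0E.
rewrite /= in UV.
rewrite /node_term (bigD1 j0) //= -/(i.*2.+1.+1) -pE.
set q : rat := (node N i)%:R.
have qr : reduces q (- (i.+1.*2)%:R : 'F_p) by apply: reduces_node.
set A := \prod_(j < N | j != j0) _; set B := \prod_(l < N | l != i) _.
have AB : reduces (A * B) (1 : 'F_p).
  rewrite -UV; apply: reducesM; apply: reduces_prod => l ll.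
    apply: reduces_div; last by rewrite expf_neq0 // Fp_natr_neq0 //; have := ltn_ord l; lia.
      apply: reducesB; first by apply/reducesX/reduces_nat.
      by rewrite -[in X in reduces _ X]sqrrN; apply: reducesX.
    by apply/reducesX/reduces_nat.
  apply: reduces_div; last by rewrite subr_eq0 Fp_dbl_sqr_eq.
    by rewrite -[in X in reduces _ X]sqrrN; apply/reducesX/reduces_node.
  apply: reducesB; first by rewrite -[in X in reduces _ X]sqrrN; apply/reducesX/reduces_node.
  by rewrite -[in X in reduces _ X]sqrrN; apply/reducesX.
pose s : rat := (i.+1.*2)%:R.
have sr : reduces s ((i.+1.*2)%:R : 'F_p) by apply: reduces_nat.
have pq : p%:R = s + q by rewrite /s /q -natrD; congr (_%:R); rewrite /node; lia.
have S0 : (i.+1.*2)%:R != 0 :> 'F_p by rewrite Fp_natr_neq0 //; lia.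
have Pr : reduces (p%:R ^+ 2 - q ^+ 2) (- ((i.+1.*2)%:R ^+ 2) : 'F_p).
  rewrite -[X in reduces _ X]sub0r -[in X in reduces _ X]sqrrN.
  apply: reducesB; last exact: reducesX.
  by rewrite expr2; apply: reduces0M red0p red0p.
have s0 : s != 0 by rewrite pnatr_eq0.
have Pq0 : p%:R ^+ 2 - q ^+ 2 != 0.
  by apply: reduces_neq0 Pr _; rewrite oppr_eq0 expf_neq0.
exists ((-1) ^+ (N - i.+1) * (q * ((s - q) / s ^+ 2 / (p%:R ^+ 2 - q ^+ 2))) * (A * B)).
  rewrite -doubleS -/s pq; rewrite pq in Pq0; field.
  by rewrite Pq0 s0.
rewrite -[X in reduces _ X]mulr1; apply: reducesM => //.
have -> : (-1) ^+ (N - i.+1) / (2 * i.+1%:R ^+ 2) =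
  (-1) ^+ (N - i.+1) * (- (i.+1.*2)%:R * (((i.+1.*2)%:R - - (i.+1.*2)%:R) /
     (i.+1.*2)%:R ^+ 2 / - ((i.+1.*2)%:R ^+ 2))) :> 'F_p.
  rewrite -[in RHS]mul2n natrM.
  have i0 : i.+1%:R != 0 :> 'F_p by rewrite Fp_natr_neq0 //; lia.
  have t0 : 2 != 0 :> 'F_p by rewrite (@Fp_natr_neq0 p p_pr 2) //; lia.
  move: i0 t0; move: (i.+1%:R : 'F_p) (_ ^+ (N - i.+1) : 'F_p) => x e x0 t0.
  by field; rewrite oppr_eq0 expf_neq0 ?mulf_neq0 // x0 t0.
apply: reducesM; first exact/reducesX/(reduces_int _ (-1)).
apply: reducesM => //; apply: reduces_div => //; last by rewrite oppr_eq0 expf_neq0.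
apply: reduces_div; last by rewrite expf_neq0.
  exact: reducesB.
exact: reducesX.
Qed.

Lemma Fp_inv_sqr (x : 'F_p) : x != 0 -> x ^+ (p - 3) = (x ^+ 2)^-1.
Proof.
move=> x0; apply: (mulIf (expf_neq0 2 x0)); rewrite mulVf ?expf_neq0 // -exprD.
by rewrite (_ : (p - 3 + 2)%N = N.*2) ?(Fp_exp_pred p_pr pE) //; lia.
Qed.

(** The alternating sum of the k^(p-3), 0 <= k <= floor(N/2), is expressed by
    E_(p-3)(floor(N/2) + 1), whose argument is 1/4 modulo p for odd N and 3/4 for
    even N. *)
Lemma reduces_euler_quarter :
  reduces (euler_poly (p - 3)).[1 / 4]
    (- (2 * (-1) ^+ N./2 * \sum_(i < N./2) (-1) ^+ i / i.+1%:R ^+ 2) : 'F_p).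
Proof.
have t0 : 2 != 0 :> 'F_p by rewrite (@Fp_natr_neq0 p p_pr 2) //; lia.
have f0 : 4 != 0 :> 'F_p by rewrite (@Fp_natr_neq0 p p_pr 4) //; lia.
have [g gP] := reduces_euler_poly (p - 3) t0.
have n_even : ~~ odd (p - 3) by rewrite pE; lia.
have n_gt0 : (0 < p - 3)%N by lia.
have p0 := pchar_Fp_0 p_pr.
have M4 : (N./2.+1)%:R = (if odd N then 1 else 3) / 4 :> 'F_p.
  apply: (mulIf f0); rewrite divfK // -natrM.
  have [oN|eN] := boolP (odd N).
    by rewrite (_ : _ * _ = p + 1)%N ?natrD ?p0 ?add0r //; lia.
  by rewrite (_ : _ * _ = p + 3)%N ?natrD ?p0 ?add0r //; lia.
have quarter : (euler_poly (p - 3)).[1 / 4] =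
    (euler_poly (p - 3)).[(if odd N then 1 else 3) / 4].
  case: ifP => // _; have := congr1 (horner^~ (1 / 4)) (euler_poly_sym (p - 3)).
  rewrite -signr_odd (negbTE n_even) scale1r horner_comp => <-.
  by congr (_.[_]); rewrite !hornerE.
have -> : - (2 * (-1) ^+ N./2 * \sum_(i < N./2) (-1) ^+ i / i.+1%:R ^+ 2) = g.[N./2.+1%:R].
  have signr k : reduces ((-1) ^+ k) ((-1) ^+ k : 'F_p).
    exact/reducesX/(reduces_int _ (-1)).
  have sum_red : reduces (\sum_(k < N./2.+1) (-1) ^+ k * k%:R ^+ (p - 3))
      (\sum_(k < N./2.+1) (-1) ^+ k * k%:R ^+ (p - 3) : 'F_p).
    by apply: reduces_sum => k _; apply: reducesM (signr k) _; apply/reducesX/reduces_nat.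
  have EM := reduces_horner gP (reduces_nat _ N./2.+1).
  have := reducesN (reduces_div (reducesM (signr N./2.+1) EM) (reduces_nat _ 2) t0).
  rewrite -euler_poly_alt_sum // => -[_ h]; move: sum_red => -[_]; rewrite h.
  rewrite big_ord_recl expr0n eqn0Ngt n_gt0 mulr0 add0r.
  rewrite (eq_bigr (fun i : 'I__ => - ((-1) ^+ i / i.+1%:R ^+ 2))) => [|i _]; last first.
    rewrite lift0 exprS mulN1r mulNr Fp_inv_sqr // Fp_natr_neq0 //.
    by have := ltn_ord i; lia.
  rewrite sumrN => /oppr_inj <-; rewrite exprS mulN1r.
  have := signrMK N./2 (g.[N./2.+1%:R]); move: (_ ^+ N./2) => e eK.
  rewrite -[LHS]mulN1r -[RHS]eK; by field.
rewrite quarter M4; apply: reduces_horner gP _; apply: reduces_div f0; last exact: reduces_nat.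
by case: ifP => _; [apply: (reduces_nat _ 1) | apply: reduces_nat].
Qed.

End PadicEstimates.

(** * The supercongruence *)

Theorem theorem1p1 (p : nat) (p_prime : prime p) (p_gt3 : (3 < p)%N) :
  congr_rat p 4
    (\sum_(0 <= n < ((p - 1) %/ 2).+1)
       (3 * n + 1)%:R / (-8) ^+ n * ('C(2 * n, n)%:R : rat) ^+ 3)
    (p%:R * (legendre (-1) p)%:~R
     + p%:R ^+ 3 / 4 * (legendre 2 p)%:~R * (euler_poly (p - 3)).[1 / 4]).
Proof.
have [N -> pE] : exists2 N, ((p - 1) %/ 2)%N = N & p = N.*2.+1.
  have p_odd : odd p by case: (even_prime p_prime) p_gt3 => // ->.
  by exists (p - 1)./2; [rewrite divn2 | lia].
have p2 : (2 < p)%N by lia.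
have -> : \sum_(0 <= n < N.+1) (3 * n + 1)%:R / (-8) ^+ n * ('C(2 * n, n)%:R : rat) ^+ 3 =
    hsum N.+1 0.
  by apply: eq_bigr => n _; rewrite hterm0 mul2n [RHS]mulrA [RHS]mulrAC.
rewrite hsum0_nodes -pE.
have [z -> z0] := leading_ratio p_prime pE p_gt3.
have nodes (i : 'I_N) := reduces_node_term p_prime pE p_gt3 i.
have [w wE wr] : exists2 w, \sum_(i < N) node_term i = p%:R ^+ 3 * w
    & reduces w (\sum_(i < N) if (i < N./2)%N
        then (-1) ^+ (N - i.+1) / (2 * i.+1%:R ^+ 2) else 0 : 'F_p).
  elim: (index_enum _) => [|i r [w wE wr]].
    by exists 0; rewrite !big_nil ?mulr0 //; apply: (reduces_nat _ 0).
  have [y yE yr] := nodes i; exists (y + w); rewrite !big_cons; first by rewrite yE wE mulrDr.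
  exact: reducesD.
rewrite wE (legendreN1 p_prime pE p2) rmorphXn rmorphN1.
rewrite /congr_rat.
set E := (euler_poly _).[_].
set L : rat := (legendre 2 p)%:~R.
have p0 : p%:R != 0 :> rat by rewrite pnatr_eq0; lia.
(* The two main terms (-1)^N p cancel exactly; what is left is p^3 times a
   p-integral number, which has to be congruent to 0 modulo p. *)
rewrite [X in denq X](_ : _ = ((-1) ^+ N * z + w - L * E / 4) / p%:R); last first.
  by field.
apply: reduces0P => //.
pose H : 'F_p := \sum_(i < N./2) (-1) ^+ i / i.+1%:R ^+ 2.
have Er : reduces E (- (2 * (-1) ^+ N./2 * H)) by apply: reduces_euler_quarter.
have Lr : reduces L ((-1) ^+ (N - N./2) : 'F_p).
  by rewrite -(Fp_legendre2 p_prime pE p2); apply: reduces_int.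
have f0 : 4 != 0 :> 'F_p by rewrite (@Fp_natr_neq0 p p_prime 4) //; lia.
have t0 : 2 != 0 :> 'F_p by rewrite (@Fp_natr_neq0 p p_prime 2) //; lia.
have signr k : reduces ((-1) ^+ k) ((-1) ^+ k : 'F_p).
  exact/reducesX/(reduces_int _ (-1)).
have := reducesB (reducesD (reducesM (signr N) z0) wr)
  (reduces_div (reducesM Lr Er) (reduces_nat _ 4) f0).
congr (reduces _ _); rewrite mulr0 add0r.
have N2 : (N./2 <= N)%N by lia.
rewrite -big_mkcond.
rewrite -(big_ord_widen N (fun i => (-1) ^+ (N - i.+1) / (2 * i.+1%:R ^+ 2) : 'F_p)) //.
have -> : \sum_(i < N./2) (-1) ^+ (N - i.+1) / (2 * i.+1%:R ^+ 2) = - ((-1) ^+ N * H / 2) :> 'F_p.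
  rewrite /H mulr_sumr mulr_suml -sumrN; apply: eq_bigr => i _.
  have iN : (i.+1 <= N)%N by have := ltn_ord i; lia.
  have -> : (-1) ^+ N = (-1) ^+ (N - i.+1) * (-1 * (-1) ^+ i) :> 'F_p.
    by rewrite -exprS -exprD subnK.
  have := sqrr_sign 'F_p i; rewrite expr2.
  move: (_ ^+ i : 'F_p) => e eE.
  have x0 : i.+1%:R != 0 :> 'F_p by rewrite Fp_natr_neq0 //; lia.
  move: x0; move: (_ ^+ (N - i.+1)) (i.+1%:R : 'F_p) => s x x0.
  transitivity (s * (e * e) / (2 * x ^+ 2)); first by rewrite eE mulr1.
  by field; rewrite t0 x0.
rewrite -[in X in - (X / 2)](subnK N2) exprD.
by field; rewrite f0 t0.
Qed.
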